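(* Let $G$ be a finite group, $p$ a prime, and $x\in G$ a $p$-element. Then $\mathrm{Sub}_G(x)$ is generated by the normalisers $\mathbf{N}_G(P)$ of those Sylow $p$-subgroups $P$ of $G$ that contain $x$.
   Context: For a subgroup $H$ of a group $G$ put $S_G(H):=\{g\in G\mid H \text{ is subnormal in } \langle g,H\rangle\}$. For $x\in G$ let $\mathrm{Sub}_G(x):=\langle S_G(\langle x\rangle)\rangle$, the subgroup of $G$ generated by the set $S_G(\langle x\rangle)$. *)

(* Defs.v *)
From mathcomp Require Import all_boot all_fingroup all_solvable.

Set Implicit Arguments.
Unset Strict Implicit.
Unset Printing Implicit Defensive.

Local Open Scope group_scope.

Definition subnormaliser_set (gT : finGroupType) (G H : {group gT}) : {set gT} :=
  [set g in G | H <|<| <<g |: H>>].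

Definition subnormaliser (gT : finGroupType) (G : {group gT}) (x : gT) : {set gT} :=
  << subnormaliser_set G <[x]> >>.

(* Main.v *)
(* If <[x]> is subnormal in K = <<g, x>>, then x lies in the p-subgroup 'O_p(K),
   which g normalises. So the nontrivial inclusion amounts to: for every
   p-subgroup U containing x, 'N_G(U) is generated by normalisers of Sylow
   subgroups containing x. This follows by descending induction on #|U|: if U is
   not Sylow in G, then it is properly contained in all Sylow p-subgroups T of
   M = 'N_G(U), and a Frattini argument shows that the 'N_M(T) generate M. *)

Require Import Defs.
From mathcomp Require Import all_boot all_fingroup all_solvable.

Set Implicit Arguments.
Unset Strict Implicit.
Unset Printing Implicit Defensive.

Local Open Scope group_scope.

(** Induction down a subnormal chain: for [L] normal in [K], ['O_pi(L)] is ['O_pi(K) :&: L], hence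
    lies in ['O_pi(K)]. *)
Lemma subnormal_sub_pcore (gT : finGroupType) (pi : nat_pred)
    (H K : {group gT}) :
  pi.-group H -> H <|<| K -> H \subset 'O_pi(K).
Proof.
move=> piH; have [n] := ubnP #|K|; elim: n K => // n IHn K /ltnSE-leKn.
case/subnormalEr=> [eqHK | [L [snHL nsLK ltLK]]].
  by rewrite -eqHK pcore_pgroup_id.
have sHL: H \subset 'O_pi(L).
  by apply: IHn snHL; apply: leq_trans (proper_card ltLK) leKn.
by apply: subset_trans sHL _; rewrite -(pcore_setI_normal pi nsLK) subsetIl.
Qed.

(** Conjugation in [M] permutes its Sylow subgroups, so the generated group [L] is normal in [M]. It
    contains a Sylow subgroup [S] together with ['N_M(S)], and Frattini gives [M = L * 'N_M(S)]. *)
Lemma Sylow_norms_gen (gT : finGroupType) (p : nat) (M : {group gT}) :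
  M \subset << \bigcup_(T : {group gT} | p.-Sylow(M) T) 'N_M(T) >>.
Proof.
set L := <<_>>.
have sNL (T : {group gT}) : p.-Sylow(M) T -> 'N_M(T) \subset L.
  by move=> sylT; rewrite sub_gen // (bigcup_max T).
have [S sylS] := Sylow_exists p M.
have sLM: L \subset M.
  by rewrite gen_subG; apply/bigcupsP=> T _; apply: subsetIl.
have nsLM: L <| M.
  rewrite /normal sLM /=; apply/normsP=> y My; apply/eqP.
  rewrite eqEcard cardJg leqnn andbT /L -genJ genS //.
  apply/subsetP=> z; rewrite mem_conjg => /bigcupP[T sylT NTz].
  apply/bigcupP; exists (T :^ y)%G; first by rewrite /= pHallJ.
  by rewrite -[M in 'N_M(_)](conjGid My) /= normJ -conjIg mem_conjg.
have sSL: S \subset L.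
  apply: subset_trans (sNL S sylS).
  by rewrite subsetI (pHall_sub sylS) normG.
have sylSL: p.-Sylow(L) S by apply: pHall_subl sylS.
rewrite -(Frattini_arg nsLM sylSL) mul_subG //.
exact: sNL.
Qed.

Lemma norm_pgroup_sub_Sylow_norms (gT : finGroupType) (G : {group gT})
    (p : nat) (x : gT) (U : {group gT}) :
    p.-group U -> U \subset G -> x \in U ->
  'N_G(U) \subset
    << \bigcup_(P : {group gT} | p.-Sylow(G) P && (x \in P)) 'N_G(P) >>.
Proof.
have [n] := ubnP (#|G| - #|U|); elim: n U => // n IHn U /ltnSE-leUn pU sUG Ux.
have [sylU | nsylU] := boolP (p.-Sylow(G) U).
  by rewrite sub_gen // (bigcup_max U) // sylU.
apply: subset_trans (Sylow_norms_gen p _) _.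
rewrite gen_subG; apply/bigcupsP=> T sylT.
have sTG: T \subset G := subset_trans (pHall_sub sylT) (subsetIl _ _).
have nsUM: U <| 'N_G(U) by apply: normalSG.
have sUT: U \subset T.
  by apply: subset_trans (pcore_max pU nsUM) (pcore_sub_Hall sylT).
have ltUT: U \proper T.
  (* A [p]-subgroup that is Sylow in its own normaliser in [G] is already Sylow in [G]. *)
  rewrite properEneq sUT andbT; apply: contra nsylU => /eqP eqUT.
  by rewrite -Sylow_subnorm [X in pHall _ _ X]eqUT.
(* Enlarge ['N_M(T)] to ['N_G(T)], to which induction applies since [T] is larger than [U]. *)
apply: subset_trans (setSI _ (subsetIl _ _)) _.
apply: IHn => //; last by apply: subsetP sUT x Ux.
  apply: leq_trans leUn; apply: ltn_sub2l; last exact: proper_card.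
  exact: leq_trans (proper_card ltUT) (subset_leq_card sTG).
exact: pHall_pgroup sylT.
Qed.

Theorem proposition2p6 (gT : finGroupType) (G : {group gT}) (p : nat) (x : gT)
    (p_prime : prime p) (xG : x \in G) (px : p.-elt x) :
  subnormaliser G x =
    << \bigcup_(P : {group gT} | p.-Sylow(G) P && (x \in P)) 'N_G(P) >>.
Proof.
apply/eqP; rewrite eqEsubset !gen_subG; apply/andP; split.
  apply/subsetP=> g; rewrite inE => /andP[Gg snxK].
  pose K := << g |: <[x]> >>%G.
  have sxO: <[x]> \subset 'O_p(K) by apply: subnormal_sub_pcore.
  have sKG: K \subset G by rewrite gen_subG subUset sub1set Gg cycle_subG.
  have Kg: g \in K by rewrite mem_gen // setU11.
  have := @norm_pgroup_sub_Sylow_norms _ G p x 'O_p(K)%G (pcore_pgroup p K)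
    (subset_trans (pcore_sub p K) sKG).
  rewrite -cycle_subG => /(_ sxO)/subsetP; apply.
  by rewrite inE Gg (subsetP (normal_norm (pcore_normal p K))).
(* Converse inclusion: [<[x]>] is subnormal in the nilpotent group [P], which is normal in
   [<<g |: P>>]. *)
apply/bigcupsP=> P /andP[sylP Px]; apply/subsetP=> g /setIP[Gg nPg].
apply: mem_gen; rewrite inE Gg /=.
have sxP: <[x]> \subset P by rewrite cycle_subG.
have nPY: P <| <<g |: P>>.
  rewrite /normal sub_gen ?subsetUr //= gen_subG subUset sub1set nPg.
  exact: normG.
have snxY: <[x]> <|<| <<g |: P>>.
  apply: subnormal_trans (normal_subnormal nPY).
  exact: nilpotent_subnormal (pgroup_nil (pHall_pgroup sylP)) sxP.
have sxK: <[x]> \subset << g |: <[x]> >> by rewrite sub_gen ?subsetUr.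
(* Subnormality passes to the smaller group [<<g |: <[x]>>>] by intersecting with it. *)
rewrite -{1}(setIidPl sxK); apply: setI_subnormal snxY.
by rewrite genS // setUS.
Qed.
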